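(* Let $\mathsf{C}$ be a quasi-Markov category such that: (1) $\mathsf{C}$ is positive and $\sigma$-continuous; (2) countable Kolmogorov products exist in $\mathsf{C}$; (3) all balanced idempotents in $\mathsf{C}$ split; (4) every object $X$ of $\mathsf{C}$ has an empirical sampling morphism $\mathsf{es}: X^{\mathbb{N}} \to X$. Then for every object $X$ of $\mathsf{C}$, the distribution object $PX$ of $X$ (with its sampling morphism $\mathsf{samp}:PX\to X$) is also a de Finetti object for $X$.
   Context: Notation: $\mathbb{N}=\{1,2,3,\ldots\}$; composition is written by juxtaposition; coherence isomorphisms are suppressed. A CD category is a symmetric monoidal category $(\mathsf{C},\otimes,I)$ in which every object $X$ carries a distinguished commutative comonoid structure $\mathrm{copy}_X:X\to X\otimes X$, $\mathrm{del}_X:X\to I$, compatible with the tensor product (these are not required to be natural). A morphism $f:A\to X$ is total if $\mathrm{del}_X f=\mathrm{del}_A$; quasi-total if $f=(f\otimes \mathrm{del}_X f)\,\mathrm{copy}_A$; copyable if $\mathrm{copy}_X f=(f\otimes f)\,\mathrm{copy}_A$; deterministic if total and copyable. A quasi-Markov category is a CD category in which every morphism is quasi-total. $\mathsf{C}_{\rm cop}$ is the wide subcategory of copyable morphisms. $\mathsf{C}$ is positive if for all $f:X\to Y$, $g:Y\to Z$ with $gf$ copyable one has $(\mathrm{id}_Y\otimes g)\,\mathrm{copy}_Y f=(f\otimes gf)\,\mathrm{copy}_X$. The domain of $f:A\to X$ is $\mathrm{dom}(f)=(\mathrm{id}_A\otimes \mathrm{del}_X f)\,\mathrm{copy}_A:A\to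 A$. For $f,g:A\to X$, write $f\sqsupseteq g$ ($f$ extends $g$) if $f\,\mathrm{dom}(g)=g$; this is a partial order on hom-sets. A positive quasi-Markov category is $\sigma$-continuous if, with respect to $\sqsupseteq$, every descending sequence $f_1\sqsupseteq f_2\sqsupseteq\cdots$ of morphisms $X\to Y$ has a meet (greatest lower bound) $\bigwedge_n f_n$, and these meets are preserved by pre- and post-composition and by tensoring with arbitrary morphisms. A Kolmogorov product $\bigotimes_{i\in\mathbb{N}}X_i$ of a sequence of objects is a limit in $\mathsf{C}$ of the diagram $\cdots\to X_1\otimes\cdots\otimes X_n\to\cdots\to X_1\otimes X_2\to X_1$ (arrows delete the last factor) whose cone components $\pi_n:\bigotimes_{i\in\mathbb{N}} X_i\to X_1\otimes\cdots\otimes X_n$ are deterministic and which is preserved by $-\otimes Y$ for every object $Y$. $X^{\mathbb{N}}$ denotes the Kolmogorov power (all $X_i=X$). For $f:A\to X$, $f^{(n)}:A\to X^{\otimes n}$ is the $n$-fold copy of $A$ followed by $f^{\otimes n}$, and $f^{(\mathbb{N})}:A\to X^{\mathbb{N}}$ is the unique morphism with $\pi_n f^{(\mathbb{N})}=f^{(n)}$ for all $n$. For a finite permutation $\sigma$ of $\mathbb{N}$ (a bijection fixing all but finitely many elements), $X^\sigma:X^{\mathbb{N}}\to X^{\mathbb{N}}$ is the induced deterministic morphism permuting the factors (its $i$-th output is its $\sigma(i)$-th input). A morphism $f:A\to X^{\mathbb{N}}\otimes Y$ is exchangeable in the first factor if $(X^\sigma\otimes \mathrm{id}_Y)f=f$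 for every finite permutation $\sigma$. An empirical sampling morphism for $X$ is a morphism $\mathsf{es}:X^{\mathbb{N}}\to X$ such that (i) $\mathsf{es}\,X^\sigma=\mathsf{es}$ for every finite permutation $\sigma$ of $\mathbb{N}$, and (ii) for all objects $A,Y$ and every $f:A\to X^{\mathbb{N}}\otimes Y$ exchangeable in the first factor, $(\mathsf{es}^{(\mathbb{N})}\otimes\mathrm{id}_Y)f=f$. An idempotent $e:X\to X$ is balanced if $(\mathrm{id}_X\otimes e)\,\mathrm{copy}_X e=(e\otimes \mathrm{id}_X)\,\mathrm{copy}_X e$. It splits if there are $\pi:X\to E$, $\iota:E\to X$ with $e=\iota\pi$ and $\pi\iota=\mathrm{id}_E$. A distribution object for $X$ is an object $PX$ with bijections $\mathsf{C}(A,X)\cong\mathsf{C}_{\rm cop}(A,PX)$ natural in $A\in\mathsf{C}_{\rm cop}$; the sampling morphism $\mathsf{samp}:PX\to X$ is the counterpart of $\mathrm{id}_{PX}$. Under the hypotheses of the claim, every object has a distribution object. A de Finetti object for $X$ is an object $QX$ with a morphism $\ell:QX\to X$ such that (i) $\ell^{(\mathbb{N})}:QX\to X^{\mathbb{N}}$ makes $QX$ the equalizer of all the morphisms $X^\sigma:X^{\mathbb{N}}\to X^{\mathbb{N}}$ for finite permutations $\sigma$, and (ii) this limit is preserved by $-\otimes Y$ for every object $Y$. *)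

(* Defs.v *)
From mathcomp Require Import all_boot.

Set Implicit Arguments.
Unset Strict Implicit.
Unset Printing Implicit Defensive.

Declare Scope cat_scope.
Delimit Scope cat_scope with cat.
Local Open Scope cat_scope.

Reserved Notation "g ∘ f" (at level 40, left associativity).
Reserved Notation "X ⊗ Y" (at level 37, left associativity).
Reserved Notation "f ⊠ g" (at level 37, left associativity).

Record Category := {
  obj :> Type;
  hom : obj -> obj -> Type;
  idm : forall X : obj, hom X X;
  comp : forall X Y Z : obj, hom Y Z -> hom X Y -> hom X Z;
  comp1m : forall (X Y : obj) (f : hom X Y), comp (idm Y) f = f;
  compm1 : forall (X Y : obj) (f : hom X Y), comp f (idm X) = f;
  compA : forall (X Y Z W : obj) (h : hom Z W) (g : hom Y Z) (f : hom X Y),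
    comp h (comp g f) = comp (comp h g) f
}.
Arguments hom {c} X Y.
Arguments idm {c} X.
Arguments comp {c X Y Z} g f.
Notation "g ∘ f" := (comp g f) : cat_scope.

(* Not assumed strict: the coherence isomorphisms are explicit.  [X ⊗ Y] is the
   tensor of objects and [f ⊠ g] that of morphisms. *)
Record SymMonCategory := {
  smc_cat :> Category;
  tens : smc_cat -> smc_cat -> smc_cat;
  tensm : forall X Y X' Y' : smc_cat,
    hom X Y -> hom X' Y' -> hom (tens X X') (tens Y Y');
  unit_ob : smc_cat;
  assoc : forall X Y Z : smc_cat, hom (tens (tens X Y) Z) (tens X (tens Y Z));
  associ : forall X Y Z : smc_cat, hom (tens X (tens Y Z)) (tens (tens X Y) Z);
  lunit : forall X : smc_cat, hom (tens unit_ob X) X;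
  luniti : forall X : smc_cat, hom X (tens unit_ob X);
  runit : forall X : smc_cat, hom (tens X unit_ob) X;
  runiti : forall X : smc_cat, hom X (tens X unit_ob);
  braid : forall X Y : smc_cat, hom (tens X Y) (tens Y X);
  tensm1 : forall X Y : smc_cat, tensm (idm X) (idm Y) = idm (tens X Y);
  tensm_comp : forall (X Y Z X' Y' Z' : smc_cat)
      (g : hom Y Z) (f : hom X Y) (g' : hom Y' Z') (f' : hom X' Y'),
    tensm (g ∘ f) (g' ∘ f') = tensm g g' ∘ tensm f f';
  assocK : forall X Y Z : smc_cat, associ X Y Z ∘ assoc X Y Z = idm _;
  associK : forall X Y Z : smc_cat, assoc X Y Z ∘ associ X Y Z = idm _;
  lunitK : forall X : smc_cat, luniti X ∘ lunit X = idm _;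
  lunitiK : forall X : smc_cat, lunit X ∘ luniti X = idm _;
  runitK : forall X : smc_cat, runiti X ∘ runit X = idm _;
  runitiK : forall X : smc_cat, runit X ∘ runiti X = idm _;
  braidK : forall X Y : smc_cat, braid Y X ∘ braid X Y = idm _;
  assoc_nat : forall (X Y Z X' Y' Z' : smc_cat)
      (f : hom X X') (g : hom Y Y') (h : hom Z Z'),
    assoc X' Y' Z' ∘ tensm (tensm f g) h = tensm f (tensm g h) ∘ assoc X Y Z;
  lunit_nat : forall (X Y : smc_cat) (f : hom X Y),
    lunit Y ∘ tensm (idm unit_ob) f = f ∘ lunit X;
  runit_nat : forall (X Y : smc_cat) (f : hom X Y),
    runit Y ∘ tensm f (idm unit_ob) = f ∘ runit X;
  braid_nat : forall (X Y X' Y' : smc_cat) (f : hom X X') (g : hom Y Y'),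
    braid X' Y' ∘ tensm f g = tensm g f ∘ braid X Y;
  triangle : forall X Y : smc_cat,
    tensm (idm X) (lunit Y) ∘ assoc X unit_ob Y = tensm (runit X) (idm Y);
  pentagon : forall X Y Z W : smc_cat,
    tensm (idm X) (assoc Y Z W) ∘ assoc X (tens Y Z) W
      ∘ tensm (assoc X Y Z) (idm W)
    = assoc X Y (tens Z W) ∘ assoc (tens X Y) Z W;
  hexagon : forall X Y Z : smc_cat,
    assoc Y Z X ∘ braid X (tens Y Z) ∘ assoc X Y Z
    = tensm (idm Y) (braid X Z) ∘ assoc Y X Z ∘ tensm (braid X Y) (idm Z)
}.
Arguments tens {s} X Y.
Arguments tensm {s X Y X' Y'} f g.
Arguments unit_ob {s}.
Arguments assoc {s} X Y Z.
Arguments associ {s} X Y Z.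
Arguments lunit {s} X.
Arguments luniti {s} X.
Arguments runit {s} X.
Arguments runiti {s} X.
Arguments braid {s} X Y.
Notation "X ⊗ Y" := (tens X Y) : cat_scope.
Notation "f ⊠ g" := (tensm f g) : cat_scope.

Definition middle_swap (C : SymMonCategory) (X Y Z W : C) :
    hom ((X ⊗ Y) ⊗ (Z ⊗ W)) ((X ⊗ Z) ⊗ (Y ⊗ W)) :=
  associ X Z (Y ⊗ W)
  ∘ (idm X ⊠ (assoc Z Y W ∘ (braid Y Z ⊠ idm W) ∘ associ Y Z W))
  ∘ assoc X Y (Z ⊗ W).

Record CDCategory := {
  cd_smc :> SymMonCategory;
  copy : forall X : cd_smc, hom X (X ⊗ X);
  del : forall X : cd_smc, hom X unit_ob;
  copy_assoc : forall X : cd_smc,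
    assoc X X X ∘ (copy X ⊠ idm X) ∘ copy X = (idm X ⊠ copy X) ∘ copy X;
  copy_runit : forall X : cd_smc, runit X ∘ (idm X ⊠ del X) ∘ copy X = idm X;
  copy_lunit : forall X : cd_smc, lunit X ∘ (del X ⊠ idm X) ∘ copy X = idm X;
  copy_comm : forall X : cd_smc, braid X X ∘ copy X = copy X;
  copy_tens : forall X Y : cd_smc,
    copy (X ⊗ Y) = middle_swap X X Y Y ∘ (copy X ⊠ copy Y);
  del_tens : forall X Y : cd_smc,
    del (X ⊗ Y) = lunit unit_ob ∘ (del X ⊠ del Y);
  copy_unit : copy unit_ob = luniti unit_ob;
  del_unit : del unit_ob = idm unit_ob
}.
Arguments copy {c} X.
Arguments del {c} X.

Definition total (C : CDCategory) (A X : C) (f : hom A X) : Prop :=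
  del X ∘ f = del A.

Definition quasi_total (C : CDCategory) (A X : C) (f : hom A X) : Prop :=
  f = runit X ∘ (f ⊠ (del X ∘ f)) ∘ copy A.

Definition copyable (C : CDCategory) (A X : C) (f : hom A X) : Prop :=
  copy X ∘ f = (f ⊠ f) ∘ copy A.

Definition deterministic (C : CDCategory) (A X : C) (f : hom A X) : Prop :=
  total f /\ copyable f.

Record QuasiMarkovCategory := {
  qm_cd :> CDCategory;
  qm_quasi_total : forall (A X : qm_cd) (f : hom A X), quasi_total f
}.

Definition positive (C : CDCategory) : Prop :=
  forall (X Y Z : C) (f : hom X Y) (g : hom Y Z),
    copyable (g ∘ f) ->
    (idm Y ⊠ g) ∘ copy Y ∘ f = (f ⊠ (g ∘ f)) ∘ copy X.

Definition dom (C : CDCategory) (A X : C) (f : hom A X) : hom A A :=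
  runit A ∘ (idm A ⊠ (del X ∘ f)) ∘ copy A.

Definition extends (C : CDCategory) (A X : C) (f g : hom A X) : Prop :=
  f ∘ dom g = g.

Definition descending (C : CDCategory) (A X : C) (f : nat -> hom A X) : Prop :=
  forall n, extends (f n) (f n.+1).

Definition is_meet (C : CDCategory) (A X : C)
    (f : nat -> hom A X) (m : hom A X) : Prop :=
  (forall n, extends (f n) m) /\
  (forall h : hom A X, (forall n, extends (f n) h) -> extends m h).

Definition sigma_continuous (C : CDCategory) : Prop :=
  forall (X Y : C) (f : nat -> hom X Y), descending f ->
  exists m : hom X Y,
    [/\ is_meet f m,
        forall (Z : C) (g : hom Y Z), is_meet (fun n => g ∘ f n) (g ∘ m),
        forall (W : C) (h : hom W X), is_meet (fun n => f n ∘ h) (m ∘ h),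
        forall (Z W : C) (k : hom Z W), is_meet (fun n => f n ⊠ k) (m ⊠ k)
      & forall (Z W : C) (k : hom Z W), is_meet (fun n => k ⊠ f n) (k ⊠ m)].

(* Sequences are indexed from 0, so [bigtens X n] has the n + 1 factors
   X 0, ..., X n. *)
Fixpoint bigtens (C : SymMonCategory) (X : nat -> C) (n : nat) : C :=
  match n with
  | 0 => X 0
  | m.+1 => bigtens X m ⊗ X m.+1
  end.

Definition drop_last (C : CDCategory) (X : nat -> C) (n : nat) :
    hom (bigtens X n.+1) (bigtens X n) :=
  runit _ ∘ (idm (bigtens X n) ⊠ del (X n.+1)).

Definition tower_cone (C : Category) (D : nat -> C)
    (d : forall n, hom (D n.+1) (D n)) (A : C) (f : forall n, hom A (D n)) :
    Prop :=
  forall n, d n ∘ f n.+1 = f n.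

Record tower_limit (C : Category) (D : nat -> C)
    (d : forall n, hom (D n.+1) (D n)) (L : C) (p : forall n, hom L (D n)) := {
  lim_cone : tower_cone d p;
  lim_lift : forall (A : C) (f : forall n, hom A (D n)),
    tower_cone d f -> hom A L;
  lim_liftE : forall (A : C) (f : forall n, hom A (D n))
      (hf : tower_cone d f) n, p n ∘ lim_lift hf = f n;
  lim_uniq : forall (A : C) (u v : hom A L),
    (forall n, p n ∘ u = p n ∘ v) -> u = v
}.

Record kolmogorov_product (C : CDCategory) (X : nat -> C) := {
  kol :> C;
  kol_proj : forall n, hom kol (bigtens X n);
  kol_det : forall n, deterministic (kol_proj n);
  kol_lim : tower_limit (drop_last X) kol_proj;
  kol_lim_tens : forall Y : C,
    tower_limit (fun n => drop_last X n ⊠ idm Y) (fun n => kol_proj n ⊠ idm Y)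
}.

Definition kolmogorov_power (C : CDCategory) (X : C) :=
  kolmogorov_product (fun _ => X).

Lemma tensm_split (C : SymMonCategory) (X Y X' Y' : C)
    (f : hom X Y) (g : hom X' Y') :
  f ⊠ g = (f ⊠ idm Y') ∘ (idm X ⊠ g).
Proof. by rewrite -tensm_comp compm1 comp1m. Qed.

Lemma total_comp (C : CDCategory) (X Y Z : C) (g : hom Y Z) (f : hom X Y) :
  total g -> total f -> total (g ∘ f).
Proof. by rewrite /total compA => -> ->. Qed.

Fixpoint tuple_upto (C : CDCategory) (A : C) (X : nat -> C)
    (g : forall i, hom A (X i)) (n : nat) : hom A (bigtens X n) :=
  match n with
  | 0 => g 0
  | m.+1 => (tuple_upto g m ⊠ g m.+1) ∘ copy A
  end.

Lemma tuple_upto_cone (C : CDCategory) (A : C) (X : nat -> C)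
    (g : forall i, hom A (X i)) :
  (forall i, total (g i)) -> tower_cone (drop_last X) (tuple_upto g).
Proof.
move=> gT n; rewrite /drop_last /= compA -(compA (runit _)) -tensm_comp.
rewrite comp1m gT tensm_split (compA (runit _)) runit_nat -!compA.
by rewrite (compA (runit _)) copy_runit compm1.
Qed.

Definition kol_tuple (C : CDCategory) (X : nat -> C) (K : kolmogorov_product X)
    (A : C) (g : forall i, hom A (X i)) (gT : forall i, total (g i)) :
    hom A K :=
  lim_lift (kol_lim K) (tuple_upto_cone gT).

Definition last_factor (C : CDCategory) (X : nat -> C) (n : nat) :
    hom (bigtens X n) (X n) :=
  match n with
  | 0 => idm (X 0)
  | m.+1 => lunit _ ∘ (del (bigtens X m) ⊠ idm (X m.+1))
  end.

Definition kol_component (C : CDCategory) (X : nat -> C)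
    (K : kolmogorov_product X) (i : nat) : hom K (X i) :=
  last_factor X i ∘ kol_proj K i.

Lemma last_factor_total (C : CDCategory) (X : nat -> C) (n : nat) :
  total (last_factor X n).
Proof.
case: n => [|n]; rewrite /total /= ?compm1 //.
by rewrite compA -lunit_nat -compA -tensm_comp comp1m compm1 del_tens.
Qed.

Lemma kol_component_total (C : CDCategory) (X : nat -> C)
    (K : kolmogorov_product X) (i : nat) : total (kol_component K i).
Proof. exact: total_comp (last_factor_total X i) (proj1 (kol_det K i)). Qed.

Lemma tuple_upto_total (C : CDCategory) (A : C) (X : nat -> C)
    (g : forall i, hom A (X i)) :
  (forall i, total (g i)) -> forall n, total (tuple_upto g n).
Proof.
move=> gT; elim=> [|n IHn] //=; rewrite /total /= del_tens.
rewrite compA -(compA (lunit _)) -tensm_comp IHn gT tensm_split.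
have -> : (del A ⊠ idm unit_ob) ∘ (idm A ⊠ del A)
  = (idm unit_ob ⊠ del A) ∘ (del A ⊠ idm A).
  by rewrite -!tensm_comp !comp1m !compm1.
by rewrite compA lunit_nat -!compA (compA (lunit _)) copy_lunit compm1.
Qed.

Lemma kol_component_tuple (C : CDCategory) (X : nat -> C)
    (K : kolmogorov_product X) (A : C) (g : forall i, hom A (X i))
    (gT : forall i, total (g i)) (i : nat) :
  kol_component K i ∘ kol_tuple K gT = g i.
Proof.
rewrite /kol_component /kol_tuple -compA lim_liftE.
case: i => [|i] /=; first by rewrite comp1m.
rewrite compA -(compA (lunit _)) -tensm_comp (tuple_upto_total gT) comp1m.
have -> : del A ⊠ g i.+1 = (idm unit_ob ⊠ g i.+1) ∘ (del A ⊠ idm A).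
  by rewrite -tensm_comp comp1m compm1.
by rewrite compA lunit_nat -!compA (compA (lunit _)) copy_lunit compm1.
Qed.

Record finperm := {
  finperm_fun :> nat -> nat;
  finperm_bij : bijective finperm_fun;
  finperm_fin : exists N, forall n, N <= n -> finperm_fun n = n
}.

(* The i-th output is the (s i)-th input, cf. [kol_component_tuple]. *)
Definition kol_perm (C : CDCategory) (X : C) (K : kolmogorov_power X)
    (s : finperm) : hom K K :=
  kol_tuple K (fun i => kol_component_total K (s i)).

Definition exchangeable (C : CDCategory) (X : C) (K : kolmogorov_power X)
    (A Y : C) (f : hom A (K ⊗ Y)) : Prop :=
  forall s : finperm, (kol_perm K s ⊠ idm Y) ∘ f = f.

Fixpoint iter_copy (C : CDCategory) (A : C) (n : nat) :
    hom A (bigtens (fun _ => A) n) :=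
  match n with
  | 0 => idm A
  | m.+1 => (iter_copy A m ⊠ idm A) ∘ copy A
  end.

Fixpoint iter_tensm (C : SymMonCategory) (A X : C) (f : hom A X) (n : nat) :
    hom (bigtens (fun _ => A) n) (bigtens (fun _ => X) n) :=
  match n with
  | 0 => f
  | m.+1 => iter_tensm f m ⊠ f
  end.

(* Samples 0, ..., n, i.e. n + 1 of them. *)
Definition samples (C : CDCategory) (A X : C) (f : hom A X) (n : nat) :
    hom A (bigtens (fun _ => X) n) :=
  iter_tensm f n ∘ iter_copy A n.

Lemma runit_tens (C : SymMonCategory) (X Y : C) :
  runit (X ⊗ Y) = (idm X ⊠ runit Y) ∘ assoc X Y unit_ob.
Proof.
have inj (f g : hom ((X ⊗ Y) ⊗ unit_ob) (X ⊗ Y)) :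
    f ⊠ idm unit_ob = g ⊠ idm unit_ob -> f = g.
  move=> e; rewrite -[f]compm1 -[g]compm1 -(runitiK (_ ⊗ unit_ob)) !compA.
  by rewrite -!runit_nat e.
apply: inj; rewrite -triangle -(tensm1 X Y).
rewrite -[LHS]comp1m -[RHS]comp1m -(assocK X Y unit_ob) -!compA; congr (_ ∘ _).
rewrite (compA (assoc _ _ _)) assoc_nat -compA -pentagon !compA -tensm_comp.
rewrite triangle comp1m -assoc_nat -compA -tensm_comp.
by rewrite comp1m.
Qed.

Lemma copy_dom (C : CDCategory) (A X : C) (f : hom A X) :
  copy A ∘ dom f = (idm A ⊠ dom f) ∘ copy A.
Proof.
rewrite /dom !compA -runit_nat runit_tens.
rewrite -(compA _ (copy A ⊠ _)).
have -> : (copy A ⊠ idm unit_ob) ∘ (idm A ⊠ (del X ∘ f))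
  = ((idm A ⊠ idm A) ⊠ (del X ∘ f)) ∘ (copy A ⊠ idm A).
  by rewrite -!tensm_comp tensm1 !comp1m !compm1.
rewrite !compA -(compA _ (assoc _ _ _)) assoc_nat.
rewrite -!compA (compA (assoc _ _ _)) copy_assoc !compA -!tensm_comp.
by rewrite !comp1m.
Qed.

Lemma samplesS (C : CDCategory) (A X : C) (f : hom A X) (n : nat) :
  samples f n.+1 = (samples f n ⊠ f) ∘ copy A.
Proof. by rewrite /samples /= compA -tensm_comp compm1. Qed.

Lemma samples_cone (C : QuasiMarkovCategory) (A X : C) (f : hom A X) :
  tower_cone (drop_last (fun _ => X)) (samples f).
Proof.
have fdom : f ∘ dom f = f.
  rewrite [RHS](qm_quasi_total f) /dom !compA -runit_nat.
  by rewrite -(compA (runit _)) -tensm_comp compm1 comp1m.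
have sdom n : samples f n ∘ dom f = samples f n.
  case: n => [|n]; first by rewrite /samples /= compm1.
  by rewrite samplesS -compA copy_dom compA -tensm_comp compm1 fdom.
move=> n; rewrite -[RHS]sdom samplesS /drop_last /dom !compA -runit_nat.
by rewrite -!(compA (runit _)) -!tensm_comp comp1m comp1m compm1.
Qed.

Definition inf_samples (C : QuasiMarkovCategory) (A X : C)
    (K : kolmogorov_power X) (f : hom A X) : hom A K :=
  lim_lift (kol_lim K) (samples_cone f).

Definition empirical_sampling (C : QuasiMarkovCategory) (X : C)
    (K : kolmogorov_power X) (es : hom K X) : Prop :=
  (forall s : finperm, es ∘ kol_perm K s = es) /\
  (forall (A Y : C) (f : hom A (K ⊗ Y)),
    exchangeable f -> (inf_samples K es ⊠ idm Y) ∘ f = f).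

Definition idempotent (C : Category) (X : C) (e : hom X X) : Prop :=
  e ∘ e = e.

Definition balanced (C : CDCategory) (X : C) (e : hom X X) : Prop :=
  (idm X ⊠ e) ∘ copy X ∘ e = (e ⊠ idm X) ∘ copy X ∘ e.

Definition splits (C : Category) (X : C) (e : hom X X) : Prop :=
  exists (E : C) (p : hom X E) (i : hom E X), e = i ∘ p /\ p ∘ i = idm E.

Definition balanced_idempotents_split (C : CDCategory) : Prop :=
  forall (X : C) (e : hom X X), idempotent e -> balanced e -> splits e.

Lemma copyable1 (C : CDCategory) (X : C) : copyable (idm X).
Proof. by rewrite /copyable tensm1 compm1 comp1m. Qed.

(* [dist_flat] does not depend on the proof of copyability, by [dist_sharpK]
   and [dist_flatK]: it is the inverse of [dist_sharp] on the set of copyable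
   morphisms. *)
Record distribution_object (C : CDCategory) (X : C) := {
  dist :> C;
  dist_sharp : forall A : C, hom A X -> hom A dist;
  dist_sharp_copyable : forall (A : C) (f : hom A X), copyable (dist_sharp f);
  dist_flat : forall (A : C) (g : hom A dist), copyable g -> hom A X;
  dist_sharpK : forall (A : C) (f : hom A X) (h : copyable (dist_sharp f)),
    dist_flat h = f;
  dist_flatK : forall (A : C) (g : hom A dist) (h : copyable g),
    dist_sharp (dist_flat h) = g;
  dist_sharp_nat : forall (A B : C) (h : hom B A) (f : hom A X),
    copyable h -> dist_sharp (f ∘ h) = dist_sharp f ∘ h
}.

Definition samp (C : CDCategory) (X : C) (P : distribution_object X) :
    hom P X :=
  dist_flat (copyable1 P).

Definition is_equalizer (C : Category) (I : Type) (A B : C) (F : I -> hom A B)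
    (E : C) (m : hom E A) : Prop :=
  (forall i j, F i ∘ m = F j ∘ m) /\
  (forall (Z : C) (h : hom Z A), (forall i j, F i ∘ h = F j ∘ h) ->
    exists! u : hom Z E, m ∘ u = h).

Definition de_finetti_object (C : QuasiMarkovCategory) (X : C)
    (K : kolmogorov_power X) (Q : C) (l : hom Q X) : Prop :=
  is_equalizer (fun s : finperm => kol_perm K s) (inf_samples K l) /\
  (forall Y : C, is_equalizer (fun s : finperm => kol_perm K s ⊠ idm Y)
                              (inf_samples K l ⊠ idm Y)).

(* Main.v *)
From mathcomp Require Import all_boot.
Require Import Defs.

Set Implicit Arguments.
Unset Strict Implicit.
Unset Printing Implicit Defensive.

Local Open Scope cat_scope.

(** Let [e := inf_samples K es : K -> K] be the operation that replaces a
    sequence by an infinite independent resample from its empirical measure.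
    The second property of [es] says that [e] fixes every exchangeable morphism
    into [K ⊗ Y].  Independent samples are exchangeable, so [e ∘ f^N = f^N] for
    all [f] (writing [f^N] for [inf_samples K f]); with [f := es] this makes [e]
    idempotent.  The first property of [es] gives [e ∘ kol_perm K s = e], so
    [(id ⊠ e) copy e] is exchangeable in its first factor, which makes [e]
    balanced ([balanced_resampling]).  Hence [e] splits as [e = i ∘ p] through
    an object [E]: [p] sends a sequence to its empirical measure, and [i] draws
    infinitely many samples from a measure.

    As [p] is a retraction of [i] and [e] fixes the exchangeable morphisms, [i]
    equalizes all finite permutations universally, even after tensoring with
    any [Y] ([de_finetti_retract]).  What has to be shown is that [i] is itself
    infinite independent sampling from [es ∘ i : E -> X] and that [E] represents
    [X] on copyable morphisms; both follow once [p] is copyable.  Positivity for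
    [p ∘ i = id] gives [copy E = (p ⊠ p) copy i], so [p] is copyable as soon as
    [(e ⊠ e) copy e = (e ⊠ e) copy].  Finite projections of both sides are
    [n + m] samples from [es], computed from [e ∘ e] and from [e] respectively,
    and [e ∘ e = e] ([pair_inf_samples], [copyable_empirical_measure]).  The
    same comparison of [f^N] with [e ∘ f^N] shows that [p ∘ f^N] is copyable for
    every [f : A -> X].  So [f |-> p ∘ f^N] and [g |-> es ∘ i ∘ g] make [E] a
    distribution object.  For any other distribution object [P], the copyable
    morphism [E -> P] corresponding to [es ∘ i] transports the splitting of [e]
    to a splitting of [e] through [inf_samples K (samp P)].

    The work with permutations rests on one consequence of positivity
    ([pair_marginals]): a morphism into a tensor product one of whose marginals
    is copyable is the pairing of its marginals.  So a copyable morphism into a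
    Kolmogorov product is determined by its components. *)

(** * Pairings and copyable morphisms *)

Definition pairing (C : CDCategory) (A X Y : C) (f : hom A X) (g : hom A Y) :
    hom A (X ⊗ Y) :=
  (f ⊠ g) ∘ copy A.

Definition projl (C : CDCategory) (X Y : C) : hom (X ⊗ Y) X :=
  runit X ∘ (idm X ⊠ del Y).

Definition projr (C : CDCategory) (X Y : C) : hom (X ⊗ Y) Y :=
  lunit Y ∘ (del X ⊠ idm Y).

Lemma tensm_pair (C : CDCategory) (A X Y X' Y' : C) (f : hom A X) (g : hom A Y)
    (h : hom X X') (k : hom Y Y') :
  (h ⊠ k) ∘ pairing f g = pairing (h ∘ f) (k ∘ g).
Proof. by rewrite /pairing compA -tensm_comp. Qed.

Lemma pair_comp (C : CDCategory) (A B X Y : C) (f : hom A X) (g : hom A Y)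
    (h : hom B A) :
  copyable h -> pairing f g ∘ h = pairing (f ∘ h) (g ∘ h).
Proof. by move=> hc; rewrite /pairing -compA hc compA -tensm_comp. Qed.

Lemma copy_pair (C : CDCategory) (X : C) : copy X = pairing (idm X) (idm X).
Proof. by rewrite /pairing tensm1 comp1m. Qed.

Lemma assoc_pair (C : CDCategory) (A X Y Z : C)
    (f : hom A X) (g : hom A Y) (h : hom A Z) :
  assoc X Y Z ∘ pairing (pairing f g) h = pairing f (pairing g h).
Proof.
have -> : pairing (pairing f g) h = ((f ⊠ g) ⊠ h) ∘ ((copy A ⊠ idm A) ∘ copy A).
  by rewrite /pairing compA -tensm_comp compm1.
rewrite compA assoc_nat -compA (compA (assoc _ _ _)) copy_assoc compA.
by rewrite -tensm_comp compm1.
Qed.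

Lemma braid_pair (C : CDCategory) (A X Y : C) (f : hom A X) (g : hom A Y) :
  braid X Y ∘ pairing f g = pairing g f.
Proof. by rewrite /pairing compA braid_nat -compA copy_comm. Qed.

Lemma pair_del_id (C : CDCategory) (X : C) :
  pairing (del X) (idm X) = luniti X.
Proof.
by rewrite -[LHS]comp1m -(lunitK X) -!compA (compA (lunit X)) copy_lunit compm1.
Qed.

Lemma pair_id_del (C : CDCategory) (X : C) :
  pairing (idm X) (del X) = runiti X.
Proof.
by rewrite -[LHS]comp1m -(runitK X) -!compA (compA (runit X)) copy_runit compm1.
Qed.

Lemma luniti_nat (C : SymMonCategory) (X Y : C) (f : hom X Y) :
  luniti Y ∘ f = (idm unit_ob ⊠ f) ∘ luniti X.
Proof.
rewrite -[RHS]comp1m -(lunitK Y) -!compA (compA (lunit Y)) lunit_nat.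
by rewrite -compA lunitiK compm1.
Qed.

Lemma runiti_nat (C : SymMonCategory) (X Y : C) (f : hom X Y) :
  runiti Y ∘ f = (f ⊠ idm unit_ob) ∘ runiti X.
Proof.
rewrite -[RHS]comp1m -(runitK Y) -!compA (compA (runit Y)) runit_nat.
by rewrite -compA runitiK compm1.
Qed.

Lemma associ_nat (C : SymMonCategory) (X Y Z X' Y' Z' : C)
    (f : hom X X') (g : hom Y Y') (h : hom Z Z') :
  associ X' Y' Z' ∘ (f ⊠ (g ⊠ h)) = ((f ⊠ g) ⊠ h) ∘ associ X Y Z.
Proof.
rewrite -[LHS]compm1 -(associK X Y Z) -compA (compA (_ ⊠ _)) -assoc_nat.
by rewrite !compA assocK comp1m.
Qed.

Lemma middle_swap_nat (C : SymMonCategory) (X Y Z W X' Y' Z' W' : C)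
    (f : hom X X') (g : hom Y Y') (h : hom Z Z') (k : hom W W') :
  middle_swap X' Y' Z' W' ∘ ((f ⊠ g) ⊠ (h ⊠ k))
  = ((f ⊠ h) ⊠ (g ⊠ k)) ∘ middle_swap X Y Z W.
Proof.
have inner : assoc Z' Y' W' ∘ (braid Y' Z' ⊠ idm W') ∘ associ Y' Z' W'
    ∘ (g ⊠ (h ⊠ k))
  = (h ⊠ (g ⊠ k)) ∘ (assoc Z Y W ∘ (braid Y Z ⊠ idm W) ∘ associ Y Z W).
  rewrite -compA associ_nat !compA; congr (_ ∘ _).
  by rewrite -assoc_nat -!compA -!tensm_comp braid_nat comp1m compm1.
rewrite /middle_swap -compA assoc_nat !compA; congr (_ ∘ _).
rewrite -compA -tensm_comp inner comp1m -associ_nat -[RHS]compA -tensm_comp.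
by rewrite compm1.
Qed.

Lemma copyable_comp (C : CDCategory) (X Y Z : C) (g : hom Y Z) (f : hom X Y) :
  copyable g -> copyable f -> copyable (g ∘ f).
Proof.
by move=> gc fc; rewrite /copyable compA gc -compA fc compA -tensm_comp.
Qed.

Lemma copyable_tensm (C : CDCategory) (X Y X' Y' : C)
    (f : hom X X') (g : hom Y Y') :
  copyable f -> copyable g -> copyable (f ⊠ g).
Proof.
move=> fc gc; rewrite /copyable !copy_tens -compA -tensm_comp fc gc.
by rewrite tensm_comp compA middle_swap_nat -compA.
Qed.

Lemma copyable_del (C : CDCategory) (X : C) : copyable (del X).
Proof.
rewrite /copyable copy_unit luniti_nat -pair_del_id tensm_pair comp1m.
by rewrite compm1.
Qed.

(** * Consequences of positivity *)

(** Positivity for [f] and its inverse [g] reads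
    [(id ⊠ g) copy f = (f ⊠ id) copy]; postcompose with [id ⊠ f].  This gives
    copyability of all coherence isomorphisms at once. *)
Lemma copyable_iso (C : CDCategory) (Cpos : positive C) (X Y : C)
    (f : hom X Y) (g : hom Y X) :
  g ∘ f = idm X -> f ∘ g = idm Y -> copyable f.
Proof.
move=> gf fg; have := @Cpos _ _ _ f g; rewrite gf => /(_ (copyable1 X)) e.
have := congr1 (fun u => (idm Y ⊠ f) ∘ u) e.
by rewrite /= !compA -!tensm_comp fg !comp1m tensm1 comp1m compm1.
Qed.

Lemma copyable_projr (C : CDCategory) (Cpos : positive C) (X Y : C) :
  copyable (projr X Y).
Proof.
apply: copyable_comp; first exact: (copyable_iso Cpos (lunitK Y) (lunitiK Y)).
exact: (copyable_tensm (copyable_del X) (copyable1 Y)).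
Qed.

Lemma copyable_projl (C : CDCategory) (Cpos : positive C) (X Y : C) :
  copyable (projl X Y).
Proof.
apply: copyable_comp; first exact: (copyable_iso Cpos (runitK X) (runitiK X)).
exact: (copyable_tensm (copyable1 X) (copyable_del Y)).
Qed.

(** Both inverses are the copy morphism of the unit object. *)
Lemma lunit_runit_unit (C : CDCategory) :
  lunit (@unit_ob C) = runit (@unit_ob C).
Proof.
have e : runiti (@unit_ob C) = luniti unit_ob.
  by rewrite -pair_id_del -pair_del_id del_unit.
by rewrite -[LHS]compm1 -(runitK unit_ob) e compA lunitiK comp1m.
Qed.

Lemma total_projr (C : CDCategory) (X Y : C) : total (projr X Y).
Proof.
rewrite /total /projr compA -lunit_nat -compA -tensm_comp comp1m compm1.
by rewrite del_tens.
Qed.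

Lemma total_projl (C : CDCategory) (X Y : C) : total (projl X Y).
Proof.
rewrite /total /projl compA -runit_nat -compA -tensm_comp comp1m compm1.
by rewrite del_tens lunit_runit_unit.
Qed.

Lemma total_pair (C : CDCategory) (A X Y : C) (f : hom A X) (g : hom A Y) :
  total f -> total g -> total (pairing f g).
Proof.
move=> fT gT; rewrite /total del_tens -compA tensm_pair fT gT.
rewrite -[X in pairing _ X]compm1 -[X in pairing X _]comp1m -tensm_pair.
rewrite pair_del_id.
by rewrite -luniti_nat compA lunitiK comp1m.
Qed.

(** After discarding, the middle swap only exchanges two unit objects, and the
    braiding of the unit object with itself is trivial because
    [copy unit_ob] is invertible and invariant under it. *)
Lemma pair_proj (C : CDCategory) (X Y : C) :
  pairing (projl X Y) (projr X Y) = idm (X ⊗ Y).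
Proof.
(* [copy_comm] for the unit object, whose copy is [luniti]. *)
have br1 : braid (@unit_ob C) unit_ob = idm _.
  rewrite -[LHS]compm1 -[RHS](lunitK unit_ob) -(lunitK unit_ob) compA.
  by rewrite -copy_unit copy_comm.
have ms1 : middle_swap X unit_ob unit_ob Y = idm _.
  by rewrite /middle_swap br1 !tensm1 compm1 associK tensm1 compm1 assocK.
rewrite /pairing copy_tens /projl /projr tensm_comp -compA.
rewrite (compA _ (middle_swap _ _ _ _)) -middle_swap_nat -compA.
rewrite -tensm_comp -/(pairing (idm X) (del X)) -/(pairing (del Y) (idm Y)).
rewrite pair_id_del pair_del_id.
by rewrite ms1 comp1m -tensm_comp runitiK lunitiK tensm1.
Qed.

Lemma lunit_braid (C : CDCategory) (X : C) :
  lunit X ∘ braid X unit_ob = runit X.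
Proof.
rewrite -[LHS]compm1 -pair_proj -compA braid_pair.
have -> : projr X unit_ob = del (X ⊗ unit_ob).
  by rewrite -total_projr del_unit comp1m.
rewrite -[projl _ _]compm1 -{1}(comp1m (del _)) -tensm_pair pair_del_id.
by rewrite compA lunit_nat -compA lunitiK compm1 /projl del_unit tensm1 compm1.
Qed.

(** Discarding [g] leaves a copy of its domain behind; if [f] has the same
    domain, quasi-totality of [f] absorbs it. *)
Lemma projl_pair (C : QuasiMarkovCategory) (A X Y : C)
    (f : hom A X) (g : hom A Y) :
  del X ∘ f = del Y ∘ g -> projl X Y ∘ pairing f g = f.
Proof.
move=> fg; rewrite /projl -compA tensm_pair comp1m -fg /pairing compA.
by rewrite -qm_quasi_total.
Qed.

Lemma projr_pair (C : QuasiMarkovCategory) (A X Y : C)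
    (f : hom A X) (g : hom A Y) :
  del X ∘ f = del Y ∘ g -> projr X Y ∘ pairing f g = g.
Proof.
move=> fg; rewrite /projr -compA tensm_pair comp1m fg -braid_pair compA.
by rewrite lunit_braid /pairing compA -qm_quasi_total.
Qed.

Lemma positive_pair (C : CDCategory) (Cpos : positive C) (X Y Z : C)
    (f : hom X Y) (g : hom Y Z) :
  copyable (g ∘ f) -> pairing (idm Y) g ∘ f = pairing f (g ∘ f).
Proof. exact: Cpos. Qed.

(** A copyable marginal is independent of everything else: positivity for [h]
    and [projr], followed by [projl] on the first factor. *)
Lemma pair_marginals (C : CDCategory) (Cpos : positive C) (A X Y : C)
    (h : hom A (X ⊗ Y)) :
  copyable (projr X Y ∘ h) -> h = pairing (projl X Y ∘ h) (projr X Y ∘ h).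
Proof.
move=> /(positive_pair Cpos) e.
rewrite -[projr X Y ∘ h]comp1m -tensm_pair -e compA tensm_pair compm1 comp1m.
by rewrite pair_proj comp1m.
Qed.

(** Write [copy (X ⊗ Y)] as the threefold pairing of [id], [projl] and [projr],
    and use positivity once for each projection. *)
Lemma copyable_marginals (C : CDCategory) (Cpos : positive C) (A X Y : C)
    (h : hom A (X ⊗ Y)) :
  copyable (projl X Y ∘ h) -> copyable (projr X Y ∘ h) -> copyable h.
Proof.
move=> hl hr.
have copyE : copy (X ⊗ Y) = assoc _ _ _
    ∘ (pairing (idm _) (projl X Y) ⊠ idm Y) ∘ pairing (idm _) (projr X Y).
  by rewrite -compA tensm_pair comp1m compm1 assoc_pair pair_proj copy_pair.
rewrite /copyable copyE -compA (positive_pair Cpos hr) -compA tensm_pair.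
by rewrite comp1m (positive_pair Cpos hl) assoc_pair -(pair_marginals Cpos hr).
Qed.

Lemma copyable_pair (C : CDCategory) (Cpos : positive C) (A X Y : C)
    (f : hom A X) (g : hom A Y) :
  copyable f -> copyable g -> copyable (pairing f g).
Proof.
move=> fc gc; apply: copyable_comp; first exact: copyable_tensm.
apply: (copyable_marginals Cpos).
- by rewrite /projl copy_runit; apply: copyable1.
- by rewrite /projr copy_lunit; apply: copyable1.
Qed.

(** * Tuples and Kolmogorov products *)

Lemma eq_tuple_upto (C : CDCategory) (A : C) (X : nat -> C)
    (g h : forall i, hom A (X i)) (n : nat) :
  (forall i, i <= n -> g i = h i) -> tuple_upto g n = tuple_upto h n.
Proof.
elim: n => [|n IHn] gh /=; first exact: gh.
by rewrite IHn ?gh // => i le_in; apply: gh; apply: leqW.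
Qed.

Lemma tuple_upto_comp (C : CDCategory) (A B : C) (X : nat -> C)
    (g : forall i, hom A (X i)) (h : hom B A) (n : nat) :
  copyable h -> tuple_upto g n ∘ h = tuple_upto (fun i => g i ∘ h) n.
Proof.
move=> hc; elim: n => [|n IHn] //=.
by rewrite -!/(pairing _ _) pair_comp // IHn.
Qed.

Lemma copyable_tuple_upto (C : CDCategory) (Cpos : positive C) (A : C)
    (X : nat -> C) (g : forall i, hom A (X i)) (n : nat) :
  (forall i, copyable (g i)) -> copyable (tuple_upto g n).
Proof. by move=> gc; elim: n => [|n IHn] //=; apply: copyable_pair. Qed.

Lemma copyable_last_factor (C : CDCategory) (Cpos : positive C)
    (X : nat -> C) (n : nat) : copyable (last_factor X n).
Proof.
case: n => [|n]; first exact: copyable1.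
exact: (copyable_projr Cpos).
Qed.

Lemma copyable_kol_component (C : CDCategory) (Cpos : positive C)
    (X : nat -> C) (K : kolmogorov_product X) (i : nat) :
  copyable (kol_component K i).
Proof.
apply: copyable_comp; first exact: copyable_last_factor.
by case: (kol_det K i).
Qed.

Lemma tuple_upto_kol_component (C : CDCategory) (Cpos : positive C)
    (X : nat -> C) (K : kolmogorov_product X) (n : nat) :
  tuple_upto (kol_component K) n = kol_proj K n.
Proof.
elim: n => [|n IHn] /=; first by rewrite /kol_component comp1m.
rewrite IHn -(lim_cone (kol_lim K)) [RHS](pair_marginals Cpos) //.
exact: (copyable_kol_component Cpos K n.+1).
Qed.

(** A product of two Kolmogorov products is tested on pairs of finite stages:
    each of the two limits is preserved by tensoring, on the left factor
    directly and on the right factor through the braiding. *)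
Lemma kol_tens_inj (C : CDCategory) (X X' : nat -> C)
    (K : kolmogorov_product X) (K' : kolmogorov_product X') (A : C)
    (u v : hom A (K ⊗ K')) :
  (forall n m, (kol_proj K n ⊠ kol_proj K' m) ∘ u
             = (kol_proj K n ⊠ kol_proj K' m) ∘ v) -> u = v.
Proof.
move=> uv; apply: (lim_uniq (kol_lim_tens K K')) => n.
have brI (w w' : hom A (bigtens X n ⊗ K')) :
    braid _ _ ∘ w = braid _ _ ∘ w' -> w = w'.
  move=> e; have := congr1 (fun z => braid _ _ ∘ z) e.
  by rewrite /= !compA braidK !comp1m.
apply: brI; apply: (lim_uniq (kol_lim_tens K' (bigtens X n))) => m.
rewrite !(compA _ (braid _ _)) -braid_nat -!compA; congr (_ ∘ _).
by rewrite !compA -!tensm_comp !comp1m !compm1 uv.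
Qed.

(** Positivity for [h] and [kol_proj K m] makes one output of the copy equal to
    the [m]-th projection of an independent run of [h]. *)
Lemma copyable_kol (C : CDCategory) (Cpos : positive C)
    (X : nat -> C) (K : kolmogorov_product X) (A : C) (h : hom A K) :
  (forall n, copyable (kol_proj K n ∘ h)) -> copyable h.
Proof.
move=> hc; apply: kol_tens_inj => n m; rewrite -/(pairing h h) tensm_pair.
have -> : (kol_proj K n ⊠ kol_proj K m) ∘ (copy K ∘ h)
  = (kol_proj K n ⊠ idm _) ∘ (pairing (idm K) (kol_proj K m) ∘ h).
  by rewrite copy_pair compA [RHS]compA !tensm_pair !compm1 comp1m.
by rewrite (positive_pair Cpos) // tensm_pair comp1m.
Qed.

Lemma kol_proj_perm (C : CDCategory) (X : C) (K : kolmogorov_power X)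
    (s : finperm) (n : nat) :
  kol_proj K n ∘ kol_perm K s = tuple_upto (fun i => kol_component K (s i)) n.
Proof. exact: lim_liftE. Qed.

Lemma copyable_kol_perm (C : CDCategory) (Cpos : positive C) (X : C)
    (K : kolmogorov_power X) (s : finperm) : copyable (kol_perm K s).
Proof.
apply: (copyable_kol Cpos) => n; rewrite kol_proj_perm.
by apply: (copyable_tuple_upto Cpos) => i; apply: copyable_kol_component.
Qed.

Definition finperm_id : finperm :=
  {| finperm_bij := Bijective (fun=> erefl) (fun=> erefl);
     finperm_fin := ex_intro _ 0 (fun _ _ => erefl) |}.

Lemma kol_perm_id (C : CDCategory) (Cpos : positive C) (X : C)
    (K : kolmogorov_power X) : kol_perm K finperm_id = idm K.
Proof.
apply: (lim_uniq (kol_lim K)) => n.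
by rewrite kol_proj_perm compm1 -(tuple_upto_kol_component Cpos).
Qed.

(** * Independent samples *)

Lemma samples_comp (C : CDCategory) (A B X : C) (f : hom A X) (h : hom B A)
    (n : nat) : copyable h -> samples (f ∘ h) n = samples f n ∘ h.
Proof.
move=> hc; elim: n => [|n IHn]; first by rewrite /samples /= !compm1.
by rewrite !samplesS -!/(pairing _ _) pair_comp // IHn.
Qed.

Lemma kol_proj_inf_samples (C : QuasiMarkovCategory) (A X : C)
    (K : kolmogorov_power X) (f : hom A X) (n : nat) :
  kol_proj K n ∘ inf_samples K f = samples f n.
Proof. exact: lim_liftE. Qed.

Lemma inf_samples_comp (C : QuasiMarkovCategory) (A B X : C)
    (K : kolmogorov_power X) (f : hom A X) (h : hom B A) :
  copyable h -> inf_samples K (f ∘ h) = inf_samples K f ∘ h.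
Proof.
move=> hc; apply: (lim_uniq (kol_lim K)) => n.
by rewrite compA !kol_proj_inf_samples samples_comp.
Qed.

(** The splitting [d] is only a rebracketing, hence the same for all [f]. *)
Lemma samples_split (C : CDCategory) (X : C) (n m : nat) :
  exists N (d : hom (bigtens (fun=> X) N)
                    (bigtens (fun=> X) n ⊗ bigtens (fun=> X) m)),
    forall (A : C) (f : hom A X),
      d ∘ samples f N = pairing (samples f n) (samples f m).
Proof.
elim: m => [|m [N [d dE]]].
  exists n.+1, (idm _) => A f.
  by rewrite comp1m samplesS [samples f 0]compm1.
exists N.+1, (assoc _ _ _ ∘ (d ⊠ idm X)) => A f.
by rewrite !samplesS -!/(pairing _ _) -compA tensm_pair comp1m dE assoc_pair.
Qed.

(** Two independent sequences of samples of one distribution carry the same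
    information as one sequence: their finite stages of lengths [n] and [m] are
    read off from a single longer stage. *)
Lemma pair_inf_samples (C : QuasiMarkovCategory) (A B D X : C)
    (K : kolmogorov_power X) (f : hom A X) (g : hom B X)
    (a : hom D A) (b : hom D B) :
  inf_samples K f ∘ a = inf_samples K g ∘ b ->
  pairing (inf_samples K f) (inf_samples K f) ∘ a
  = pairing (inf_samples K g) (inf_samples K g) ∘ b.
Proof.
move=> e; apply: kol_tens_inj => n m.
rewrite compA [RHS]compA !tensm_pair !kol_proj_inf_samples.
have [N [d dE]] := samples_split X n m.
by rewrite -!dE -!(kol_proj_inf_samples K) -!compA e.
Qed.

(** Further samples do not shrink the domain, since dropping the last one is
    total. *)
Lemma del_samples (C : QuasiMarkovCategory) (A X : C) (f : hom A X) (n : nat) :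
  del _ ∘ samples f n = del X ∘ f.
Proof.
elim: n => [|n IHn]; first by rewrite [samples f 0]compm1.
rewrite -IHn -(samples_cone f n) compA.
by have -> := total_projl (bigtens (fun=> X) n) X.
Qed.

Lemma projr_samples (C : QuasiMarkovCategory) (A X : C) (f : hom A X)
    (n : nat) :
  projr _ _ ∘ pairing (samples f n) f = f.
Proof. by rewrite projr_pair // del_samples. Qed.

(** * Exchangeability of independent samples *)

Fixpoint coord (C : CDCategory) (X : C) (N i : nat) :
    hom (bigtens (fun=> X) N) X :=
  match N with
  | 0 => idm X
  | M.+1 => if i == M.+1 then projr _ _ else coord X M i ∘ projl _ _
  end.

Lemma kol_component_coord (C : CDCategory) (X : C) (K : kolmogorov_power X)
    (N i : nat) :
  i <= N -> kol_component K i = coord X N i ∘ kol_proj K N.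
Proof.
elim: N => [|N IHN]; first by rewrite leqn0 => /eqP->.
rewrite leq_eqVlt => /predU1P[->|lt_iN] /=; first by rewrite eqxx.
by rewrite ltn_eqF // -compA [X in _ ∘ X](lim_cone (kol_lim K)) IHN.
Qed.

Lemma coord_samples (C : QuasiMarkovCategory) (A X : C) (f : hom A X)
    (N i : nat) :
  i <= N -> coord X N i ∘ samples f N = f.
Proof.
elim: N => [|N IHN]; first by rewrite [samples f 0]compm1 comp1m.
rewrite leq_eqVlt => /predU1P[->|lt_iN] /=.
  by rewrite eqxx samplesS projr_samples.
by rewrite ltn_eqF // -compA [X in _ ∘ X]samples_cone IHN.
Qed.

(** Taking coordinate [i] out of a list of [N.+2] coordinates, which leaves
    the others in order.  [d] is a composite of braidings and associators, which
    act on independent samples of [f] by permuting identical factors. *)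
Lemma extract_coord (C : QuasiMarkovCategory) (Cpos : positive C)
    (X : C) (N i : nat) :
  i <= N.+1 ->
  exists d : hom (bigtens (fun=> X) N.+1) (bigtens (fun=> X) N ⊗ X),
    [/\ deterministic d,
        projr _ _ ∘ d = coord X N.+1 i,
        forall k, k <= N ->
          coord X N k ∘ (projl _ _ ∘ d) = coord X N.+1 (bump i k)
      & forall (A : C) (f : hom A X),
          d ∘ samples f N.+1 = pairing (samples f N) f].
Proof.
elim: N => [|N IHN] in i *; rewrite leq_eqVlt => /predU1P[->|lt_iN].
- exists (idm _); split=> [||k|A f]; rewrite ?compm1 ?comp1m ?samplesS //.
    by split; [rewrite /total compm1 | apply: copyable1].
  by rewrite leqn0 => /eqP->; rewrite [RHS]comp1m.
- have -> : i = 0 by case: i lt_iN.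
  have brE : braid X X = pairing (projr X X) (projl X X).
    by rewrite -braid_pair pair_proj compm1.
  exists (braid X X); split=> [||k|A f]; rewrite ?samplesS ?braid_pair ?brE //.
  - split; first exact: (total_pair (total_projr _ _) (total_projl _ _)).
    apply: (copyable_pair Cpos); first exact: copyable_projr.
    exact: copyable_projl.
  - by rewrite projr_pair ?total_projl ?total_projr //= comp1m.
  - rewrite leqn0 => /eqP->.
    by rewrite projl_pair ?total_projl ?total_projr //= comp1m.
  by rewrite [samples f 0]compm1.
- exists (idm _); split=> [||k le_kN|A f]; rewrite ?compm1 ?comp1m ?samplesS //.
  - by split; [rewrite /total compm1 | apply: copyable1].
  - by rewrite /= eqxx.
  by rewrite /bump leqNgt ltnS le_kN [RHS]/= add0n ltn_eqF.
have [d [[dT dc] dr dl dS]] := IHN i lt_iN.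
(* Moves the coordinate extracted by [d] past the last coordinate. *)
pose w := associ (bigtens (fun=> X) N) X X ∘ (idm _ ⊠ braid X X) ∘ assoc _ X X.
have w_pair (A : C) f (g h : hom A X) :
    w ∘ pairing (pairing f g) h = pairing (pairing f h) g.
  rewrite -!compA assoc_pair tensm_pair comp1m braid_pair -assoc_pair.
  by rewrite compA assocK comp1m.
have plc := copyable_projl Cpos; have prc := copyable_projr Cpos.
have plT := @total_projl C; have prT := @total_projr C.
set l := projl (bigtens (fun=> X) N.+1) X.
set r := projr (bigtens (fun=> X) N.+1) X.
(* As [d] is copyable, so that [pair_marginals] applies, the new extraction is
   an explicit tuple of total morphisms, whose components can be read off. *)
have DE : w ∘ (d ⊠ idm X)
    = pairing (pairing (projl _ _ ∘ d ∘ l) r) (projr _ _ ∘ d ∘ l).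
  rewrite -w_pair -[d ⊠ _]compm1 -pair_proj tensm_pair comp1m.
  congr (_ ∘ pairing _ _); rewrite {1}[d](pair_marginals Cpos) ?pair_comp //.
  exact: copyable_comp.
have fT : total (projl _ _ ∘ d ∘ l).
  exact: (total_comp (total_comp (plT _ _) dT) (plT _ _)).
have gT : total (projr _ _ ∘ d ∘ l).
  exact: (total_comp (total_comp (prT _ _) dT) (plT _ _)).
have fgT : total (pairing (projl _ _ ∘ d ∘ l) r).
  by apply: total_pair => //; apply: prT.
have fc : copyable (projl _ _ ∘ d ∘ l).
  exact: (copyable_comp (copyable_comp (plc _ _) dc) (plc _ _)).
have gc : copyable (projr _ _ ∘ d ∘ l).
  exact: (copyable_comp (copyable_comp (prc _ _) dc) (plc _ _)).
exists (w ∘ (d ⊠ idm X)); split=> [||k|A f].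
- rewrite DE; split; first exact: total_pair.
  exact: (copyable_pair Cpos (copyable_pair Cpos fc (prc _ _)) gc).
- by rewrite DE projr_pair ?fgT // dr [RHS]/= (ltn_eqF lt_iN).
- rewrite DE projl_pair ?fgT // leq_eqVlt => /predU1P[->|lt_kN].
    rewrite [LHS]/= eqxx projr_pair ?fT ?(prT _ _) //.
    by rewrite /bump (lt_iN : i <= N.+1) /= eqxx.
  rewrite [LHS]/= ltn_eqF // -compA projl_pair ?fT ?(prT _ _) // compA dl //.
  rewrite [RHS]/= ltn_eqF // /bump ltnS.
  by case: (i <= k) => //; apply: leqW.
by rewrite samplesS -/(pairing _ _) -compA tensm_pair comp1m dS w_pair samplesS.
Qed.

(** Selecting distinct coordinates from independent samples gives independent
    samples.  Induction on the number of selected coordinates: the last one is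
    taken out by [extract_coord], and the others are selected from what remains,
    where [unbump] is their renumbering. *)
Lemma tuple_upto_samples (C : QuasiMarkovCategory) (Cpos : positive C)
    (A X : C) (f : hom A X) (n N : nat) (s : nat -> nat) :
  (forall i, i <= n -> s i <= N) ->
  (forall i j, i <= n -> j <= n -> s i = s j -> i = j) ->
  tuple_upto (fun i => coord X N (s i)) n ∘ samples f N = samples f n.
Proof.
elim: n N s => [|n IHn] N s sN s_inj /=.
  by rewrite coord_samples ?sN // [samples f 0]compm1.
have s_neq i : i <= n -> s i != s n.+1.
  move=> le_in; apply/eqP => /(s_inj _ _ (leqW le_in) (leqnn _)) e.
  by rewrite e ltnn in le_in.
(* A single coordinate cannot be selected twice. *)
case: N => [|N] in sN s_neq *.
  have:= s_neq 0 isT; have := sN 0 isT; have := sN n.+1 (leqnn _).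
  by rewrite !leqn0 => /eqP-> /eqP->.
have [d [[_ dc] dr dl dS]] := extract_coord Cpos X (sN _ (leqnn _)).
pose t i := unbump (s n.+1) (s i).
have sE i : i <= n -> s i = bump (s n.+1) (t i).
  by move=> le_in; rewrite unbumpK // inE s_neq.
have tN i : i <= n -> t i <= N.
  move=> le_in; have := s_neq i le_in; have := sN i (leqW le_in).
  have := sN n.+1 (leqnn _); rewrite /t /unbump.
  case: ltngtP => // [_ _|lt_s sN1 _ _]; first by rewrite subn1; case: (s i).
  by rewrite subn0 -ltnS (leq_trans lt_s).
have -> : tuple_upto (fun i => coord X N.+1 (s i)) n
    = tuple_upto (fun i => coord X N (t i)) n ∘ (projl _ _ ∘ d).
  rewrite (tuple_upto_comp (X := fun=> X)); last first.
    by apply: copyable_comp => //; apply: (copyable_projl Cpos).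
  by apply: eq_tuple_upto => i le_in; rewrite dl ?tN // -sE.
rewrite -/(pairing _ _) -dr -[projr _ _ ∘ d]comp1m -tensm_pair.
rewrite -(pair_marginals Cpos); last first.
  by apply: copyable_comp => //; apply: (copyable_projr Cpos).
rewrite -compA dS tensm_pair comp1m IHn // => [|i j le_in le_jn /= e].
  by rewrite samplesS.
by apply: s_inj; rewrite ?leqW // (sE i) // (sE j) // [t i]e.
Qed.

(** The first coordinates of the permuted sequence are distinct coordinates of
    a long enough finite stage. *)
Lemma exchangeable_inf_samples (C : QuasiMarkovCategory) (Cpos : positive C)
    (A X : C) (K : kolmogorov_power X) (f : hom A X) (s : finperm) :
  kol_perm K s ∘ inf_samples K f = inf_samples K f.
Proof.
apply: (lim_uniq (kol_lim K)) => n.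
rewrite compA kol_proj_perm kol_proj_inf_samples.
have [N sN] : exists N, forall i, i <= n -> s i <= N.
  exists (\max_(i < n.+1) s i) => i le_in.
  exact: (@leq_bigmax _ (fun j : 'I_n.+1 => s j) (Ordinal (le_in : i < n.+1))).
rewrite (eq_tuple_upto (fun i le_in => kol_component_coord K (sN i le_in))).
rewrite -(tuple_upto_comp (X := fun=> X)); last by case: (kol_det K N).
rewrite -compA kol_proj_inf_samples tuple_upto_samples // => i j _ _.
exact: (bij_inj (finperm_bij s)).
Qed.

(** * The empirical measure *)

(** The case [Y := unit_ob] of the second property of [es]. *)
Lemma resample_exchangeable (C : QuasiMarkovCategory) (X : C)
    (K : kolmogorov_power X) (es : hom K X) (esP : empirical_sampling es)
    (A : C) (h : hom A K) :
  (forall s : finperm, kol_perm K s ∘ h = h) -> inf_samples K es ∘ h = h.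
Proof.
move=> hK; have ex : exchangeable (runiti K ∘ h).
  by move=> s; rewrite compA -runiti_nat -compA hK.
have := proj2 esP _ _ _ ex; rewrite compA -runiti_nat -compA.
by move/(congr1 (fun u => runit K ∘ u)); rewrite !compA runitiK !comp1m.
Qed.

Lemma resample_inf_samples (C : QuasiMarkovCategory) (Cpos : positive C) (X : C)
    (K : kolmogorov_power X) (es : hom K X) (esP : empirical_sampling es)
    (A : C) (f : hom A X) :
  inf_samples K es ∘ inf_samples K f = inf_samples K f.
Proof.
by apply: resample_exchangeable => // s; apply: exchangeable_inf_samples.
Qed.

(** [pairing id e ∘ e] is exchangeable in its first factor, so it equals
    [pairing e e ∘ e], which is symmetric. *)
Lemma balanced_resampling (C : QuasiMarkovCategory) (Cpos : positive C) (X : C)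
    (K : kolmogorov_power X) (es : hom K X) (esP : empirical_sampling es) :
  balanced (inf_samples K es).
Proof.
set e := inf_samples K es.
have e_perm s : e ∘ kol_perm K s = e.
  by rewrite -inf_samples_comp ?(proj1 esP) //; apply: copyable_kol_perm.
have ex : exchangeable (pairing (idm K) e ∘ e).
  move=> s; rewrite compA tensm_pair compm1 comp1m.
  have -> : pairing (kol_perm K s) e = pairing (idm K) e ∘ kol_perm K s.
    by rewrite pair_comp ?comp1m ?e_perm //; apply: copyable_kol_perm.
  by rewrite -compA exchangeable_inf_samples.
have := proj2 esP _ _ _ ex; rewrite -/e compA tensm_pair compm1 comp1m => ee.
rewrite /balanced -/(pairing (idm K) e) -/(pairing e (idm K)) -ee.
by rewrite -[pairing e e]braid_pair -compA ee compA braid_pair.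
Qed.

(** The equalizer of the permutations is absolute: it is the splitting of [e],
    because [e] fixes precisely the exchangeable morphisms.  Comparing with the
    identity permutation turns equality of all permutations on [h] into
    exchangeability of [h]. *)
Lemma de_finetti_retract (C : QuasiMarkovCategory) (Cpos : positive C) (X : C)
    (K : kolmogorov_power X) (es : hom K X) (esP : empirical_sampling es)
    (Q : C) (l : hom Q X) (r : hom K Q) :
  inf_samples K l ∘ r = inf_samples K es -> r ∘ inf_samples K l = idm Q ->
  de_finetti_object K l.
Proof.
move=> lr rl; split=> [|Y]; split.
- by move=> s t; rewrite !(exchangeable_inf_samples Cpos).
- move=> Z h hP; exists (r ∘ h); split=> [|u <-]; last first.
    by rewrite compA rl comp1m.
  rewrite compA lr; apply: resample_exchangeable => // s.
  by rewrite (hP s finperm_id) kol_perm_id // comp1m.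
- by move=> s t; rewrite -!tensm_comp !(exchangeable_inf_samples Cpos).
- move=> Z h hP; exists ((r ⊠ idm Y) ∘ h); split=> [|u <-].
    rewrite compA -tensm_comp lr comp1m; apply: (proj2 esP) => s.
    by rewrite (hP s finperm_id) kol_perm_id // tensm1 comp1m.
  by rewrite compA -tensm_comp rl comp1m tensm1 comp1m.
Qed.

(** The strong law of large numbers: an empirical sample of independent samples
    of [f] is distributed as [f]. *)
Lemma es_sampled (C : QuasiMarkovCategory) (Cpos : positive C) (X : C)
    (K : kolmogorov_power X) (es : hom K X) (esP : empirical_sampling es)
    (A : C) (f : hom A X) :
  es ∘ inf_samples K f = f.
Proof.
have sample0 (B : C) (g : hom B X) : kol_proj K 0 ∘ inf_samples K g = g.
  by rewrite kol_proj_inf_samples [LHS]compm1.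
by rewrite -{1}(sample0 _ es) -compA resample_inf_samples.
Qed.

(** Resampling twice independently, [pairing e e], does not change when the
    sequence is first resampled once. *)
Lemma copyable_empirical_measure (C : QuasiMarkovCategory) (Cpos : positive C)
    (X : C) (K : kolmogorov_power X) (es : hom K X)
    (esP : empirical_sampling es) (E : C) (p : hom K E) (i : hom E K) :
  inf_samples K es = i ∘ p -> p ∘ i = idm E -> copyable p.
Proof.
move=> ip pi; set e := inf_samples K es in ip *.
(* The sample [i] of a measure determines it, by positivity for [p ∘ i = id]. *)
have copyE : copy E = pairing p p ∘ i.
  have -> : pairing p p ∘ i = (p ⊠ idm E) ∘ (pairing (idm K) p ∘ i).
    by rewrite [RHS]compA tensm_pair compm1 comp1m.
  rewrite (positive_pair Cpos); last by rewrite pi; apply: copyable1.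
  by rewrite tensm_pair pi comp1m -copy_pair.
have ee : pairing e e ∘ e = pairing e e ∘ idm K.
  by apply: pair_inf_samples; rewrite compm1 resample_inf_samples.
have pE : pairing p p = (p ⊠ p) ∘ pairing e e.
  by rewrite tensm_pair ip compA pi comp1m.
by rewrite /copyable -/(pairing p p) copyE -compA -ip pE -compA ee compm1.
Qed.

Lemma inf_samples_empirical (C : QuasiMarkovCategory) (Cpos : positive C)
    (X : C) (K : kolmogorov_power X) (es : hom K X)
    (esP : empirical_sampling es) (E : C) (p : hom K E) (i : hom E K) :
  inf_samples K es = i ∘ p -> p ∘ i = idm E -> inf_samples K (es ∘ i) = i.
Proof.
move=> ip pi; have pc := copyable_empirical_measure Cpos esP ip pi.
rewrite -[LHS]compm1 -pi compA -(inf_samples_comp _ _ pc) -compA -ip.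
by rewrite es_sampled // ip -compA pi compm1.
Qed.

(** Comparing [inf_samples K f] with its resampling reduces this to copyability
    of [p]: the samples of [f] are also samples of [es], run on themselves. *)
Lemma copyable_empirical_samples (C : QuasiMarkovCategory) (Cpos : positive C)
    (X : C) (K : kolmogorov_power X) (es : hom K X)
    (esP : empirical_sampling es) (E : C) (p : hom K E) (i : hom E K)
    (ip : inf_samples K es = i ∘ p) (pi : p ∘ i = idm E)
    (A : C) (f : hom A X) :
  copyable (p ∘ inf_samples K f).
Proof.
have pc := copyable_empirical_measure Cpos esP ip pi.
have ff : pairing (inf_samples K f) (inf_samples K f) ∘ idm A
    = pairing (inf_samples K es) (inf_samples K es) ∘ inf_samples K f.
  by apply: pair_inf_samples; rewrite compm1 resample_inf_samples.
rewrite /copyable -/(pairing (p ∘ _) (p ∘ _)) -tensm_pair.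
rewrite -[pairing (inf_samples K f) _]compm1 ff ip compA [RHS]compA tensm_pair.
by rewrite compA pi comp1m pc.
Qed.

(** Copyable morphisms into [E] can be moved out of [inf_samples], which is why
    [f |-> p ∘ inf_samples K f] inverts [g |-> es ∘ i ∘ g] on them. *)
Lemma empirical_distribution_object (C : QuasiMarkovCategory)
    (Cpos : positive C) (X : C) (K : kolmogorov_power X) (es : hom K X)
    (esP : empirical_sampling es) (E : C) (p : hom K E) (i : hom E K) :
  inf_samples K es = i ∘ p -> p ∘ i = idm E ->
  inhabited (distribution_object X).
Proof.
move=> ip pi; constructor.
apply: (@Build_distribution_object C X E
          (fun A f => p ∘ inf_samples K f)
          (copyable_empirical_samples Cpos esP ip pi)
          (fun A g _ => es ∘ i ∘ g)) => [A f _|A g gc|A B h f hc].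
- by rewrite -compA (compA i) -ip resample_inf_samples // es_sampled.
- rewrite inf_samples_comp // (inf_samples_empirical Cpos esP ip pi) compA pi.
  by rewrite comp1m.
- by rewrite inf_samples_comp // compA.
Qed.

(** * Sampling from a distribution object *)

Lemma dist_sharp_samp (C : CDCategory) (X : C) (P : distribution_object X)
    (A : C) (g : hom A P) : copyable g -> dist_sharp P (samp P ∘ g) = g.
Proof. by move=> gc; rewrite dist_sharp_nat // dist_flatK comp1m. Qed.

Lemma samp_sharp (C : CDCategory) (X : C) (P : distribution_object X)
    (A : C) (f : hom A X) : samp P ∘ dist_sharp P f = f.
Proof.
have fc := dist_sharp_copyable P f.
rewrite -[RHS](dist_sharpK fc) -[LHS](dist_sharpK (dist_sharp_copyable P _)).
move: (dist_sharp_copyable P _); rewrite dist_sharp_samp // => gc.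
by rewrite !dist_sharpK.
Qed.

(** The comparison [q : E -> P] is copyable, so
    [inf_samples K (samp P) ∘ q = i], and [q ∘ p] followed by
    [inf_samples K (samp P)] is the resampling.  That [q ∘ p] retracts
    [inf_samples K (samp P)] holds because copyable endomorphisms of [P] are
    determined by their composite with [samp P]. *)
Lemma de_finetti_samp (C : QuasiMarkovCategory) (Cpos : positive C)
    (X : C) (K : kolmogorov_power X) (es : hom K X)
    (esP : empirical_sampling es) (E : C) (p : hom K E) (i : hom E K)
    (P : distribution_object X) :
  inf_samples K es = i ∘ p -> p ∘ i = idm E -> de_finetti_object K (samp P).
Proof.
move=> ip pi; pose q := dist_sharp P (es ∘ i).
have qc : copyable q by apply: dist_sharp_copyable.
apply: (de_finetti_retract Cpos esP (r := q ∘ p)).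
  rewrite compA -inf_samples_comp // samp_sharp.
  by rewrite (inf_samples_empirical Cpos esP ip pi).
have qsc := copyable_comp qc
  (copyable_empirical_samples Cpos esP ip pi (samp P)).
rewrite -compA -(dist_sharp_samp qsc) compA samp_sharp -compA (compA i) -ip.
rewrite resample_inf_samples // es_sampled // -[samp P]compm1.
by rewrite dist_sharp_samp //; apply: copyable1.
Qed.

Theorem corollary4p5 (C : QuasiMarkovCategory)
    (Cpos : positive C) (Ccont : sigma_continuous C)
    (K : forall X : nat -> C, kolmogorov_product X)
    (Csplit : balanced_idempotents_split C)
    (Ces : forall X : C, exists es : hom (K (fun _ => X)) X,
      empirical_sampling es) :
  forall X : C,
    inhabited (distribution_object X) /\
    forall P : distribution_object X,
      de_finetti_object (K (fun _ => X)) (samp P).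
Proof.
move=> X; have [es esP] := Ces X.
have [E [p [i [ip pi]]]] := Csplit _ _ (resample_inf_samples Cpos esP es)
  (balanced_resampling Cpos esP).
split; first exact: (empirical_distribution_object Cpos esP ip pi).
by move=> P; apply: (de_finetti_samp Cpos esP P ip pi).
Qed.
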